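(* Problem $(\mathrm{P}_2)$ has a unique solution, given by $$T_2(x,t)=t^{\alpha/2}\theta_\infty\left[A_2\left(1-\frac{x}{s_2(t)}\right)+B_2\left(1-\frac{x}{s_2(t)}\right)^2\right],\qquad s_2(t)=2a\nu_2\sqrt{t},$$ where the constants $A_2$ and $B_2$ are given by $$A_2=\frac{6\,\mathrm{Ste}-2\,\mathrm{Ste}\,\nu_2^2(\alpha+1)-3\cdot 2^{\alpha+1}\nu_2^{\alpha+2}}{\mathrm{Ste}\left(\nu_2^2(\alpha+1)+3\right)},\qquad B_2=\frac{-3\,\mathrm{Ste}+3\,\mathrm{Ste}\,\nu_2^2(\alpha+1)+3\cdot 2^{\alpha+1}\nu_2^{\alpha+2}}{\mathrm{Ste}\left(\nu_2^2(\alpha+1)+3\right)},$$ and where $\nu_2$ is the unique positive solution to the equation $$2^{\alpha}(\alpha+1)z^{\alpha+4}+3\cdot 2^{\alpha+1}z^{\alpha+2}+\mathrm{Ste}(\alpha+1)z^2-3\,\mathrm{Ste}=0,\qquad z>0.$$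
   Context: Fix real parameters $k,\rho,c,\gamma,\theta_\infty>0$ and $\alpha\ge 0$; put $a=\sqrt{k/(\rho c)}$ and define the generalized Stefan number $\mathrm{Ste}=\dfrac{k\theta_\infty}{\gamma a^{\alpha+2}}$. A candidate pair $(T,s)$ consists of a continuous function $s:[0,\infty)\to[0,\infty)$, positive and continuously differentiable on $(0,\infty)$, and a function with quadratic profile in space $$T(x,t)=t^{\alpha/2}\theta_\infty\left[A\left(1-\frac{x}{s(t)}\right)+B\left(1-\frac{x}{s(t)}\right)^2\right],\quad 0\le x\le s(t),\ t>0,$$ with real constants $A,B$. Problem $(\mathrm{P}_2)$ (modified heat balance integral method, Dirichlet condition): find a candidate pair $(T,s)=(T_2,s_2)$ such that, for all $t>0$: (i) $\dfrac{d}{dt}\displaystyle\int_0^{s(t)}T(x,t)\,dx=-a^2\left[\dfrac{\gamma}{k}s(t)^{\alpha}\dot s(t)+\dfrac{\partial T}{\partial x}(0,t)\right]$; (ii) $T(0,t)=\theta_\infty t^{\alpha/2}$; (iii) $T(s(t),t)=0$; (iv) $k\dfrac{\partial T}{\partial x}(s(t),t)=-\gamma s(t)^{\alpha}\dot s(t)$; and (v) $s(0)=0$. Uniqueness is meant among candidate pairs. *)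

(* Defs.v *)
From Stdlib Require Import Reals.
From Coquelicot Require Import Coquelicot.
Open Scope R_scope.

(* Real powers are written with [Rpower], which is the usual power for a
   positive base; every base below is positive wherever it matters. *)

Definition diffusion (k rho c : R) : R := sqrt (k / (rho * c)).

Definition stefan_number (k gamma theta alpha a : R) : R :=
  k * theta / (gamma * Rpower a (alpha + 2)).

(* [T x t] is only meaningful for 0 <= x <= s t, so at the two ends of this
   interval the derivative in x is one-sided. *)
Definition is_right_derive (f : R -> R) (x l : R) : Prop :=
  filterlim (fun y => (f y - f x) / (y - x)) (at_right x) (locally l).

Definition is_left_derive (f : R -> R) (x l : R) : Prop :=
  filterlim (fun y => (f y - f x) / (y - x)) (at_left x) (locally l).

Definition profile (theta alpha A B : R) (s : R -> R) (x t : R) : R :=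
  Rpower t (alpha / 2) * theta *
    (A * (1 - x / s t) + B * (1 - x / s t) ^ 2).

(* Functions on [0, +oo) and on { (x, t) | 0 <= x <= s t, 0 < t } are
   represented by total functions whose other values are unconstrained. *)
Record candidate (theta alpha : R) (T : R -> R -> R) (s : R -> R) : Prop := {
  cand_nonneg : forall t, 0 <= t -> 0 <= s t;
  cand_continuous : continuous_on (fun t => 0 <= t) s;
  cand_pos : forall t, 0 < t -> 0 < s t;
  cand_C1 : forall t, 0 < t -> ex_derive s t /\ continuous (Derive s) t;
  cand_profile : exists A B : R, forall x t,
    0 < t -> 0 <= x <= s t -> T x t = profile theta alpha A B s x t
}.

Record solves_P2 (k rho c gamma theta alpha : R)
    (T : R -> R -> R) (s : R -> R) : Prop := {
  P2_candidate : candidate theta alpha T s;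
  P2_heat_balance : forall t, 0 < t ->
    exists Tx0 : R, is_right_derive (fun x => T x t) 0 Tx0 /\
      is_derive (fun u => RInt (fun x => T x u) 0 (s u)) t
        (- (diffusion k rho c) ^ 2 *
           (gamma / k * Rpower (s t) alpha * Derive s t + Tx0));
  P2_dirichlet : forall t, 0 < t -> T 0 t = theta * Rpower t (alpha / 2);
  P2_front_temperature : forall t, 0 < t -> T (s t) t = 0;
  P2_stefan : forall t, 0 < t ->
    exists Txs : R, is_left_derive (fun x => T x t) (s t) Txs /\
      k * Txs = - gamma * Rpower (s t) alpha * Derive s t;
  P2_front_initial : s 0 = 0
}.

Definition nu2_equation (Ste alpha z : R) : Prop :=
  Rpower 2 alpha * (alpha + 1) * Rpower z (alpha + 4)
    + 3 * Rpower 2 (alpha + 1) * Rpower z (alpha + 2)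
    + Ste * (alpha + 1) * z ^ 2 - 3 * Ste = 0.

Definition A2 (Ste alpha nu : R) : R :=
  (6 * Ste - 2 * Ste * nu ^ 2 * (alpha + 1)
     - 3 * Rpower 2 (alpha + 1) * Rpower nu (alpha + 2))
  / (Ste * (nu ^ 2 * (alpha + 1) + 3)).

Definition B2 (Ste alpha nu : R) : R :=
  (- 3 * Ste + 3 * Ste * nu ^ 2 * (alpha + 1)
     + 3 * Rpower 2 (alpha + 1) * Rpower nu (alpha + 2))
  / (Ste * (nu ^ 2 * (alpha + 1) + 3)).

Definition s2 (a nu t : R) : R := 2 * a * nu * sqrt t.

Definition T2 (theta Ste alpha a nu x t : R) : R :=
  profile theta alpha (A2 Ste alpha nu) (B2 Ste alpha nu) (s2 a nu) x t.

(* Main.v *)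
(* The two boundary conditions at the front turn the Stefan condition into
   [(s ^ (alpha + 2))' = const * t ^ (alpha / 2)], which together with [s 0 = 0]
   forces [s t = C * sqrt t].  For such a front every remaining condition is
   independent of [t], and (P_2) reduces to three algebraic equations in
   [(C, A, B)].  Writing [C = 2 a nu], two of them give [A] and [B] in terms of
   [nu] and the last one is the equation for [nu], whose left-hand side is
   increasing and changes sign on the positive half-line. *)

Require Import Defs.
From Stdlib Require Import Reals Lra.
From Coquelicot Require Import Coquelicot.
Open Scope R_scope.

(** * One-sided derivatives and difference quotients *)

Lemma is_derive_difference_quotient (f : R -> R) (x l : R) :
  is_derive f x l ->
  filterlim (fun y => (f y - f x) / (y - x)) (locally' x) (locally l).
Proof.
  intros Hf. apply is_derive_Reals in Hf.
  apply filterlim_locally. intros eps.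
  destruct (Hf eps (cond_pos eps)) as [d Hd].
  exists d. intros y Hy Hyx.
  specialize (Hd (y - x) (Rminus_eq_contra _ _ Hyx) Hy).
  rewrite Rplus_minus in Hd. exact Hd.
Qed.

Lemma is_derive_right (f : R -> R) (x l : R) :
  is_derive f x l -> is_right_derive f x l.
Proof.
  intros Hf P HP.
  destruct (is_derive_difference_quotient f x l Hf P HP) as [d Hd].
  exists d. intros y Hy Hxy. apply Hd; [exact Hy | lra].
Qed.

Lemma is_derive_left (f : R -> R) (x l : R) :
  is_derive f x l -> is_left_derive f x l.
Proof.
  intros Hf P HP.
  destruct (is_derive_difference_quotient f x l Hf P HP) as [d Hd].
  exists d. intros y Hy Hxy. apply Hd; [exact Hy | lra].
Qed.

(** The right filter at [x] sees only points of [(x, b)], where both quotients agree, and limits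
    along it are unique. This lets the slope of [T], prescribed only for [0 <= x <= s t], be read
    off from the globally smooth profile. *)
Lemma is_right_derive_unique_on (f g : R -> R) (x b l m : R) :
  x < b -> (forall y, x <= y <= b -> f y = g y) ->
  is_right_derive f x l -> is_derive g x m -> l = m.
Proof.
  intros Hxb Hfg Hf Hg. apply is_derive_right in Hg.
  apply (filterlim_locally_unique
           (F := at_right x) (fun y => (f y - f x) / (y - x))); [exact Hf|].
  refine (filterlim_ext_loc _ _ _ Hg).
  exists (mkposreal (b - x) ltac:(lra)). intros y Hy Hxy.
  change (Rabs (y - x) < b - x) in Hy. apply Rabs_def2 in Hy.
  rewrite !Hfg by lra. reflexivity.
Qed.

Lemma is_left_derive_unique_on (f g : R -> R) (x b l m : R) :
  b < x -> (forall y, b <= y <= x -> f y = g y) ->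
  is_left_derive f x l -> is_derive g x m -> l = m.
Proof.
  intros Hxb Hfg Hf Hg. apply is_derive_left in Hg.
  apply (filterlim_locally_unique
           (F := at_left x) (fun y => (f y - f x) / (y - x))); [exact Hf|].
  refine (filterlim_ext_loc _ _ _ Hg).
  exists (mkposreal (x - b) ltac:(lra)). intros y Hy Hxy.
  change (Rabs (y - x) < x - b) in Hy. apply Rabs_def2 in Hy.
  rewrite !Hfg by lra. reflexivity.
Qed.

(** * Real powers of a positive base *)

Lemma Rpower_pos (x p : R) : 0 < Rpower x p.
Proof. apply exp_pos. Qed.

Lemma Rpower_2 (x : R) : 0 < x -> Rpower x 2 = x ^ 2.
Proof. intros Hx. rewrite <- Rpower_pow by exact Hx. f_equal. Qed.

Lemma Rpower_plus2 (x p : R) : 0 < x -> Rpower x (p + 2) = Rpower x p * x ^ 2.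
Proof. intros Hx. rewrite Rpower_plus, Rpower_2; auto. Qed.

Lemma Rpower_sqrt_base (t p : R) : 0 < t -> Rpower (sqrt t) p = Rpower t (p / 2).
Proof.
  intros Ht. rewrite <- Rpower_sqrt by exact Ht.
  rewrite Rpower_mult. f_equal. field.
Qed.

Lemma Rpower_1_base (p : R) : Rpower 1 p = 1.
Proof. unfold Rpower. rewrite ln_1, Rmult_0_r. apply exp_0. Qed.

Lemma Rpower_le_1 (x p : R) : 0 < x <= 1 -> 0 <= p -> Rpower x p <= 1.
Proof.
  intros [Hx Hx1] Hp. rewrite <- (Rpower_1_base p).
  apply Rle_Rpower_l; lra.
Qed.

(** A crude linear bound near [0]; it replaces limits of powers at [0+], both for the front law and
    for the sign of the [nu] equation at a small argument. *)
Lemma Rpower_le_id (x p : R) : 0 < x <= 1 -> 1 <= p -> Rpower x p <= x.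
Proof.
  intros Hx Hp. replace p with ((p - 1) + 1) by ring.
  rewrite Rpower_plus, Rpower_1 by lra.
  assert (H := Rpower_le_1 x (p - 1) Hx ltac:(lra)).
  apply Rmult_le_compat_r with (r := x) in H; lra.
Qed.

Lemma Rpower_base_inj (x y p : R) :
  0 < p -> 0 < x -> 0 < y -> Rpower x p = Rpower y p -> x = y.
Proof.
  intros Hp Hx Hy E.
  destruct (Rtotal_order x y) as [H | [H | H]]; [| exact H |].
  - assert (K := Rlt_Rpower_l x y p Hp (conj Hx H)). lra.
  - assert (K := Rlt_Rpower_l y x p Hp (conj Hy H)). lra.
Qed.

Lemma is_derive_Rpower (x p : R) :
  0 < x -> is_derive (fun y => Rpower y p) x (p * Rpower x (p - 1)).
Proof. intros Hx. apply is_derive_Reals, derivable_pt_lim_power, Hx. Qed.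

Lemma continuity_pt_Rpower (x p : R) :
  0 < x -> continuity_pt (fun y => Rpower y p) x.
Proof.
  intros Hx. apply derivable_continuous_pt.
  eexists. apply derivable_pt_lim_power, Hx.
Qed.

Lemma locally_pos (x : R) : 0 < x -> locally x (fun y => 0 < y).
Proof. intros Hx. exact (open_gt 0 x Hx). Qed.

(** * The square-root law for the front *)

Lemma is_derive_scal_sqrt (C t : R) :
  0 < t -> is_derive (fun u => C * sqrt u) t (C / (2 * sqrt t)).
Proof.
  intros Ht. assert (H := sqrt_lt_R0 t Ht).
  auto_derive; [exact Ht | field; lra].
Qed.

Lemma continuous_scal_sqrt (C t : R) : continuous (fun u => C * sqrt u) t.
Proof.
  apply (continuous_mult (fun _ => C) sqrt).
  - apply continuous_const.
  - apply continuous_sqrt.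
Qed.

(* The differential equation says that [s ^ (p + 2) - 2 D t ^ (p / 2 + 1)] has
   zero derivative; it tends to [0] at [0+], hence vanishes. *)
Lemma front_sqrt_law (p D : R) (s : R -> R) :
  0 <= p -> continuous_on (fun t => 0 <= t) s -> s 0 = 0 ->
  (forall t, 0 < t -> 0 < s t) ->
  (forall t, 0 < t -> ex_derive s t) ->
  (forall t, 0 < t ->
     Rpower (s t) p * Derive s t * s t = D * Rpower t (p / 2)) ->
  forall t, 0 <= t -> s t = s 1 * sqrt t.
Proof.
  intros Hp Hcont Hs0 Hpos Hder Hode.
  set (h := fun t => Rpower (s t) (p + 2) - 2 * D * Rpower t (p / 2 + 1)).
  assert (Hh' : forall t, 0 < t -> is_derive h t zero).
  { intros t Ht.
    assert (Hst := Hpos t Ht).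
    assert (H1 := is_derive_comp _ _ _ _ _
      (is_derive_Rpower (s t) (p + 2) Hst) (Derive_correct s t (Hder t Ht))).
    assert (H2 := is_derive_scal _ _ (2 * D) _
      (is_derive_Rpower t (p / 2 + 1) Ht)).
    assert (H3 := is_derive_minus _ _ _ _ _ H1 H2).
    refine (eq_ind _ (is_derive h t) H3 _ _).
    change (Derive s t * ((p + 2) * Rpower (s t) (p + 2 - 1))
      - 2 * D * ((p / 2 + 1) * Rpower t (p / 2 + 1 - 1)) = 0).
    replace (p + 2 - 1) with (p + 1) by ring.
    replace (p / 2 + 1 - 1) with (p / 2) by ring.
    rewrite Rpower_plus, Rpower_1 by exact Hst.
    replace (Derive s t * ((p + 2) * (Rpower (s t) p * s t)))
      with ((p + 2) * (Rpower (s t) p * Derive s t * s t)) by ring.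
    rewrite (Hode t Ht). field. }
  assert (Hh0 : forall t, 0 < t -> h t = 0).
  { intros t Ht. apply cond_eq. intros eps Heps. rewrite Rminus_0_r.
    (* The value [h t] equals [h u] for every [0 < u < t], so a single [u] with [h u] small is
       enough. Continuity at [0] gives [s u < e], hence a first term below [eps / 2]. The bound
       [u <= w] keeps the second term below [eps / 2]; the [+ 1] in [w] covers [D = 0]. *)
    set (e := Rmin 1 (eps / 2)).
    assert (He : 0 < e) by (apply Rmin_pos; lra).
    assert (He1 : e <= 1) by apply Rmin_l.
    assert (He2 : e <= eps / 2) by apply Rmin_r.
    assert (HD := Rabs_pos D).
    destruct (proj1 (filterlim_locally _ _)
      (Hcont 0 (Rle_refl 0)) (mkposreal e He)) as [d Hd].
    set (w := eps / (4 * (Rabs D + 1))).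
    assert (Hw : 0 < w) by (apply Rdiv_lt_0_compat; lra).
    assert (Hw' : w * (4 * (Rabs D + 1)) = eps) by (unfold w; field; lra).
    assert (Hu : exists u, 0 < u /\ u < d /\ u < t /\ u <= 1 /\ u <= w).
    { assert (Hd0 := cond_pos d).
      exists (Rmin (Rmin (d / 2) (t / 2)) (Rmin 1 w)).
      assert (K1 := Rmin_l (Rmin (d / 2) (t / 2)) (Rmin 1 w)).
      assert (K2 := Rmin_r (Rmin (d / 2) (t / 2)) (Rmin 1 w)).
      assert (K3 := Rmin_l (d / 2) (t / 2)).
      assert (K4 := Rmin_r (d / 2) (t / 2)).
      assert (K5 := Rmin_l 1 w).
      assert (K6 := Rmin_r 1 w).
      split; [repeat apply Rmin_pos; lra | lra]. }
    destruct Hu as (u & Hu & Hud & Hut & Hu1 & Huw).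
    assert (Hball : ball 0 d u).
    { change (Rabs (u - 0) < d). rewrite Rminus_0_r, Rabs_right; lra. }
    assert (Hsu := Hd u Hball (Rlt_le _ _ Hu)).
    change (Rabs (s u - s 0) < e) in Hsu.
    rewrite Hs0, Rminus_0_r in Hsu.
    assert (Hsu0 := Hpos u Hu).
    rewrite Rabs_right in Hsu by lra.
    rewrite <- (eq_is_derive h u t (fun v Hv => Hh' v ltac:(lra)) Hut).
    assert (K1 := Rpower_le_id (s u) (p + 2) ltac:(lra) ltac:(lra)).
    assert (K2 := Rpower_le_id u (p / 2 + 1) ltac:(lra) ltac:(lra)).
    assert (K3 := Rpower_pos (s u) (p + 2)).
    assert (K4 := Rpower_pos u (p / 2 + 1)).
    unfold h.
    eapply Rle_lt_trans; [apply Rabs_triang|].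
    rewrite Rabs_Ropp, !Rabs_mult.
    rewrite (Rabs_right (Rpower (s u) _)), (Rabs_right (Rpower u _)) by lra.
    rewrite (Rabs_right 2) by lra.
    assert (K5 : Rabs D * Rpower u (p / 2 + 1) <= Rabs D * w)
      by (apply Rmult_le_compat_l; lra).
    lra. }
  intros t [Ht | <-]; [| rewrite Hs0, sqrt_0; ring].
  assert (Hsq := sqrt_lt_R0 t Ht).
  assert (Hs1 := Hpos 1 Rlt_0_1).
  (* No root is extracted: both sides are compared after raising to the power [p + 2], and [h 1 = 0]
     identifies [2 * D] with the corresponding power of [s 1]. *)
  apply (Rpower_base_inj _ _ (p + 2)).
  - lra.
  - apply Hpos, Ht.
  - apply Rmult_lt_0_compat; assumption.
  - rewrite <- Rpower_mult_distr by assumption.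
    rewrite Rpower_sqrt_base by exact Ht.
    replace ((p + 2) / 2) with (p / 2 + 1) by field.
    assert (E1 := Hh0 1 Rlt_0_1). assert (Et := Hh0 t Ht).
    unfold h in E1, Et. rewrite Rpower_1_base in E1.
    replace (Rpower (s 1) (p + 2)) with (2 * D) by lra. lra.
Qed.

(** * Slope, integral and heat content of the quadratic profile *)

Lemma is_derive_profile (theta alpha A B : R) (s : R -> R) (x t : R) :
  s t <> 0 ->
  is_derive (fun y => profile theta alpha A B s y t) x
    (- (Rpower t (alpha / 2) * theta * (A + 2 * B * (1 - x / s t)) / s t)).
Proof. intros Hs. unfold profile. auto_derive; [exact I | field; exact Hs]. Qed.

Lemma RInt_profile (theta alpha A B : R) (s : R -> R) (t : R) :
  s t <> 0 ->
  RInt (fun x => profile theta alpha A B s x t) 0 (s t) =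
    Rpower t (alpha / 2) * theta * s t * (A / 2 + B / 3).
Proof.
  intros Hs. apply is_RInt_unique.
  (* This antiderivative in [x] vanishes at the front [x = s t], so the integral is [- P 0]. *)
  set (P := fun x => - (Rpower t (alpha / 2) * theta * s t *
    (A * (1 - x / s t) ^ 2 / 2 + B * (1 - x / s t) ^ 3 / 3))).
  replace (Rpower t (alpha / 2) * theta * s t * (A / 2 + B / 3))
    with (minus (P (s t)) (P 0)).
  - apply (is_RInt_derive (V := R_CompleteNormedModule) P).
    + intros x _. unfold P, profile. auto_derive; [exact I | field; exact Hs].
    + intros x _. apply (ex_derive_continuous (V := R_NormedModule)).
      eexists. apply is_derive_profile, Hs.
  - unfold minus, plus, opp, P; simpl. field. exact Hs.
Qed.

(* (P_2) for the front [s t = C * sqrt t] and the profile with coefficients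
   [A], [B]: respectively the Dirichlet condition, the Stefan condition and the
   heat balance. *)
Definition P2_system (k gamma theta alpha a C A B : R) : Prop :=
  A + B = 1 /\
  gamma * Rpower C (alpha + 2) = 2 * k * theta * A /\
  C ^ 2 * (alpha + 1) * (A / 2 + B / 3) = 4 * a ^ 2 * B.

(** For a square-root front the content is a constant times the power [(alpha + 1) / 2] of [t]; [m]
    stands for the spatial mean factor [A / 2 + B / 3]. *)
Lemma is_derive_heat_content (theta alpha C m t : R) :
  0 < t ->
  is_derive (fun u => Rpower u (alpha / 2) * theta * (C * sqrt u) * m) t
    (theta * C * m * ((alpha + 1) / 2) * Rpower t (alpha / 2) / sqrt t).
Proof.
  intros Ht. assert (Hsq := sqrt_lt_R0 t Ht).
  apply (is_derive_ext_loc
    (fun u => theta * C * m * Rpower u (alpha / 2 + / 2))).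
  - apply filter_imp with (2 := locally_pos t Ht). intros u Hu.
    rewrite Rpower_plus, Rpower_sqrt by exact Hu.
    apply Rminus_diag_uniq. ring.
  - assert (H := is_derive_scal _ _ (theta * C * m) _
      (is_derive_Rpower t (alpha / 2 + / 2) Ht)).
    refine (eq_ind _ (is_derive _ t) H _ _).
    replace (alpha / 2 + / 2 - 1) with (alpha / 2 + - / 2) by field.
    rewrite Rpower_plus, Rpower_Ropp, Rpower_sqrt by exact Ht.
    unfold scal; simpl; unfold mult; simpl. field. lra.
Qed.

(** * Passage between (P_2) and the algebraic system *)

Lemma sqrt_front_candidate (theta alpha C A B : R) :
  0 < C ->
  candidate theta alpha
    (profile theta alpha A B (fun t => C * sqrt t)) (fun t => C * sqrt t).
Proof.
  intros HC. split.
  - intros t _. apply Rmult_le_pos; [lra | apply sqrt_pos].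
  - intros t _. apply (filterlim_filter_le_1 (F := locally t)).
    + apply filter_le_within.
    + apply continuous_scal_sqrt.
  - intros t Ht. apply Rmult_lt_0_compat; [exact HC | apply sqrt_lt_R0, Ht].
  - intros t Ht. split; [eexists; apply is_derive_scal_sqrt, Ht|].
    apply (continuous_ext_loc _ (fun u => C / (2 * sqrt u))).
    + apply filter_imp with (2 := locally_pos t Ht). intros u Hu.
      symmetry. apply is_derive_unique, is_derive_scal_sqrt, Hu.
    + assert (Hsq := sqrt_lt_R0 t Ht).
      apply (ex_derive_continuous (V := R_NormedModule)).
      auto_derive. repeat split; lra.
  - exists A, B. reflexivity.
Qed.

(** The existence direction. Both boundary slopes, the front term and the rate of change of the heat
    content carry the same factor [Rpower t (alpha / 2) / sqrt t], which cancels. *)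
Lemma P2_system_solves (k rho c gamma theta alpha C A B : R) :
  0 < k -> 0 < C ->
  P2_system k gamma theta alpha (diffusion k rho c) C A B ->
  solves_P2 k rho c gamma theta alpha
    (profile theta alpha A B (fun t => C * sqrt t)) (fun t => C * sqrt t).
Proof.
  intros Hk HC (HAB & HSt & Hhb).
  set (a := diffusion k rho c) in *.
  set (s := fun t => C * sqrt t).
  assert (Hs : forall t, 0 < t -> 0 < s t).
  { intros t Ht. apply Rmult_lt_0_compat; [exact HC | apply sqrt_lt_R0, Ht]. }
  (* The second equation of the system in time-dependent form; it serves the heat balance as well as
     the Stefan condition. *)
  assert (Hflux : forall t, 0 < t ->
    gamma * Rpower (s t) alpha * Derive s t =
      k * (Rpower t (alpha / 2) * theta * A / s t)).
  { intros t Ht. assert (Hsq := sqrt_lt_R0 t Ht).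
    assert (HD : Derive s t = C / (2 * sqrt t))
      by apply is_derive_unique, is_derive_scal_sqrt, Ht.
    rewrite HD. unfold s.
    rewrite <- Rpower_mult_distr, Rpower_sqrt_base by assumption.
    rewrite Rpower_plus2 in HSt by exact HC.
    apply (Rmult_eq_reg_r (2 * C * sqrt t)); [| nra].
    transitivity (gamma * (Rpower C alpha * C ^ 2) * Rpower t (alpha / 2)).
    - field. lra.
    - rewrite HSt. field. lra. }
  split.
  - apply sqrt_front_candidate, HC.
  - intros t Ht. assert (Hst := Hs t Ht). assert (Hsq := sqrt_lt_R0 t Ht).
    exists (- (Rpower t (alpha / 2) * theta * (A + 2 * B * (1 - 0 / s t)) / s t)).
    split; [apply is_derive_right, is_derive_profile; lra|].
    apply (is_derive_ext_loc
      (fun u => Rpower u (alpha / 2) * theta * (C * sqrt u) * (A / 2 + B / 3))).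
    + apply filter_imp with (2 := locally_pos t Ht). intros u Hu.
      symmetry. apply (RInt_profile theta alpha A B s u), Rgt_not_eq, (Hs u Hu).
    + refine (eq_ind _ (is_derive _ t)
        (is_derive_heat_content theta alpha C (A / 2 + B / 3) t Ht) _ _).
      (* Up to a common factor the front term contributes [A] and the slope at [x = 0] contributes
         [- (A + 2 * B)]. Thus [A] cancels, and the remaining [2 * B] is the origin of
         [4 * a ^ 2 * B] in the system. *)
      replace (gamma / k * Rpower (s t) alpha * Derive s t)
        with (/ k * (gamma * Rpower (s t) alpha * Derive s t)) by (field; lra).
      rewrite (Hflux t Ht).
      change (s t) with (C * sqrt t).
      apply (Rmult_eq_reg_r (2 * C)); [| lra].
      transitivity (theta * Rpower t (alpha / 2) / sqrt t *
        (C ^ 2 * (alpha + 1) * (A / 2 + B / 3))).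
      * field. lra.
      * fold a. rewrite Hhb. field. lra.
  - intros t Ht. assert (Hst := Hs t Ht). change (fun t => C * sqrt t) with s.
    unfold profile. replace B with (1 - A) by lra. field. lra.
  - intros t Ht. assert (Hst := Hs t Ht). change (C * sqrt t) with (s t).
    change (fun t => C * sqrt t) with s. unfold profile. field. lra.
  - intros t Ht. assert (Hst := Hs t Ht).
    exists (- (Rpower t (alpha / 2) * theta * (A + 2 * B * (1 - s t / s t)) / s t)).
    split; [apply is_derive_left, is_derive_profile; lra|].
    change (fun t => C * sqrt t) with s.
    transitivity (- (gamma * Rpower (s t) alpha * Derive s t)); [| ring].
    rewrite (Hflux t Ht). field. lra.
  - unfold s. rewrite sqrt_0. ring.
Qed.

(** The uniqueness direction. The Stefan condition at all times fixes the shape of the front, with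
    [C = s 1]; the three equations then follow from the conditions at [t = 1] alone. *)
Lemma solves_P2_system (k rho c gamma theta alpha : R)
    (T : R -> R -> R) (s : R -> R) :
  0 < k -> 0 < gamma -> 0 < theta -> 0 <= alpha ->
  solves_P2 k rho c gamma theta alpha T s ->
  exists C A B : R,
    0 < C /\ P2_system k gamma theta alpha (diffusion k rho c) C A B /\
    (forall t, 0 <= t -> s t = C * sqrt t) /\
    (forall x t, 0 < t -> 0 <= x <= s t ->
       T x t = profile theta alpha A B (fun u => C * sqrt u) x t).
Proof.
  intros Hk Hgamma Htheta Halpha
    [[_ Hcont Hpos HC1 (A & B & HT)] Hhb Hdir _ HSt Hs0].
  set (a := diffusion k rho c) in *.
  assert (HAB : A + B = 1).
  { assert (Hs1 := Hpos 1 Rlt_0_1). assert (H := Hdir 1 Rlt_0_1).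
    rewrite HT in H by lra. unfold profile in H.
    rewrite Rpower_1_base in H.
    apply (Rmult_eq_reg_l theta); [| lra].
    rewrite <- H. field. lra. }
  (* At [x = s t] the quadratic part has zero slope, so only [A] enters. Multiplying by [s t] gives
     the differential equation required by [front_sqrt_law], with [D = k * theta * A / gamma]. *)
  assert (Hflux : forall t, 0 < t ->
    gamma * Rpower (s t) alpha * Derive s t * s t =
      k * theta * A * Rpower t (alpha / 2)).
  { intros t Ht. assert (Hst := Hpos t Ht).
    destruct (HSt t Ht) as (Txs & HTxs & E).
    rewrite (is_left_derive_unique_on _ _ _ 0 _ _ Hst
      (fun y Hy => HT y t Ht Hy) HTxs
      (is_derive_profile theta alpha A B s (s t) t (Rgt_not_eq _ _ Hst))) in E.
    replace (gamma * Rpower (s t) alpha * Derive s t)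
      with (- (- gamma * Rpower (s t) alpha * Derive s t)) by ring.
    rewrite <- E. field. lra. }
  assert (Hsqrt : forall t, 0 <= t -> s t = s 1 * sqrt t).
  { apply (front_sqrt_law alpha (k * theta * A / gamma)); try assumption.
    - intros t Ht. apply (HC1 t Ht).
    - intros t Ht. apply (Rmult_eq_reg_l gamma); [| lra].
      transitivity (k * theta * A * Rpower t (alpha / 2)).
      + rewrite <- (Hflux t Ht). ring.
      + field. lra. }
  assert (HC := Hpos 1 Rlt_0_1).
  remember (s 1) as C eqn:EC.
  assert (HDs : Derive s 1 = C / 2).
  { apply is_derive_unique.
    apply (is_derive_ext_loc (fun u => C * sqrt u)).
    - apply filter_imp with (2 := locally_pos 1 Rlt_0_1). intros u Hu.
      symmetry. apply Hsqrt. lra.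
    - assert (H := is_derive_scal_sqrt C 1 Rlt_0_1).
      rewrite sqrt_1, Rmult_1_r in H. exact H. }
  assert (Hflux1 := Hflux 1 Rlt_0_1).
  rewrite HDs, <- EC, Rpower_1_base in Hflux1.
  exists C, A, B. split; [exact HC|]. split; [| split; [exact Hsqrt|]].
  - split; [exact HAB|]. split.
    + rewrite Rpower_plus2 by exact HC. lra.
    + destruct (Hhb 1 Rlt_0_1) as (Tx0 & HTx0 & Hbal).
      rewrite <- EC, HDs in Hbal.
      assert (Hs1 : 0 < s 1) by (rewrite <- EC; exact HC).
      rewrite (is_right_derive_unique_on _ _ _ (s 1) _ _ Hs1
        (fun y Hy => HT y 1 Rlt_0_1 Hy) HTx0
        (is_derive_profile theta alpha A B s 0 1 (Rgt_not_eq _ _ Hs1))) in Hbal.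
      (* A second computation of the derivative in the heat balance, now from the explicit profile;
         uniqueness of the derivative then yields the third equation. *)
      assert (Hbal' : is_derive (fun u => RInt (fun x => T x u) 0 (s u)) 1
        (theta * C * (A / 2 + B / 3) * ((alpha + 1) / 2) *
           Rpower 1 (alpha / 2) / sqrt 1)).
      { apply (is_derive_ext_loc (fun u =>
          Rpower u (alpha / 2) * theta * (C * sqrt u) * (A / 2 + B / 3))).
        - apply filter_imp with (2 := locally_pos 1 Rlt_0_1). intros u Hu.
          assert (Hsu := Hpos u Hu).
          rewrite <- Hsqrt by lra. rewrite <- RInt_profile by lra.
          apply RInt_ext. intros x Hx.
          rewrite Rmin_left, Rmax_right in Hx by lra.
          symmetry. apply HT; lra.
        - apply is_derive_heat_content, Rlt_0_1. }
      apply is_derive_unique in Hbal. apply is_derive_unique in Hbal'.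
      rewrite Hbal in Hbal'. rewrite <- EC, Rpower_1_base, sqrt_1 in Hbal'.
      apply (Rmult_eq_reg_l (theta / (2 * C)));
        [| apply Rgt_not_eq, Rdiv_lt_0_compat; lra].
      transitivity (theta * C * (A / 2 + B / 3) * ((alpha + 1) / 2) * 1 / 1).
      * field. lra.
      * rewrite <- Hbal'.
        replace (gamma / k * Rpower C alpha * (C / 2))
          with (/ (k * C) * (gamma * Rpower C alpha * (C / 2) * C))
          by (field; lra).
        rewrite Hflux1. field. lra.
  - intros x t Ht Hx. rewrite HT by assumption.
    unfold profile. rewrite Hsqrt by lra. reflexivity.
Qed.

(** * Elimination of [A] and [B] *)

Lemma P2_system_nu (k gamma theta alpha a nu A B : R) :
  0 < k -> 0 < gamma -> 0 < theta -> 0 <= alpha -> 0 < a -> 0 < nu ->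
  let Ste := stefan_number k gamma theta alpha a in
  P2_system k gamma theta alpha a (2 * a * nu) A B <->
  nu2_equation Ste alpha nu /\ A = A2 Ste alpha nu /\ B = B2 Ste alpha nu.
Proof.
  intros Hk Hgamma Htheta Halpha Ha Hnu Ste.
  assert (HSte : 0 < Ste).
  { apply Rdiv_lt_0_compat; repeat apply Rmult_lt_0_compat; try lra.
    apply Rpower_pos. }
  unfold P2_system, nu2_equation, A2, B2.
  (* In terms of [q] and [w] the system reads [A + B = 1], [q = Ste * A], [w * (A / 2 + B / 3) = B],
     and the equation for [nu] becomes [q * w / 2 + 3 * q + Ste * w - 3 * Ste = 0]. All powers of
     [a] are absorbed into [Ste]. *)
  set (q := Rpower 2 (alpha + 1) * Rpower nu (alpha + 2)).
  set (w := nu ^ 2 * (alpha + 1)).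
  assert (Hw : 0 < w).
  { apply Rmult_lt_0_compat; [apply pow_lt, Hnu | lra]. }
  assert (HStefan : gamma * Rpower (2 * a * nu) (alpha + 2) = 2 * k * theta * A
                    <-> q = Ste * A).
  { assert (Hkt : k * theta = Ste * (gamma * Rpower a (alpha + 2))).
    { unfold Ste, stefan_number. field.
      split; apply Rgt_not_eq; [apply Rpower_pos | exact Hgamma]. }
    assert (HX : 0 < 2 * (gamma * Rpower a (alpha + 2))).
    { assert (H := Rmult_lt_0_compat _ _ Hgamma (Rpower_pos a (alpha + 2))). lra. }
    rewrite <- !Rpower_mult_distr by (try apply Rmult_lt_0_compat; lra).
    replace (Rpower 2 (alpha + 2)) with (2 * Rpower 2 (alpha + 1)).
    2: { replace (alpha + 2) with (alpha + 1 + 1) by ring.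
         rewrite (Rpower_plus (alpha + 1)), (Rpower_1 2) by lra. ring. }
    replace (2 * k * theta * A) with (2 * A * (k * theta)) by ring.
    rewrite Hkt. unfold q. split; intros E.
    - apply (Rmult_eq_reg_l (2 * (gamma * Rpower a (alpha + 2)))); lra.
    - apply (f_equal (Rmult (2 * (gamma * Rpower a (alpha + 2))))) in E. lra. }
  assert (Hnueq : Rpower 2 alpha * (alpha + 1) * Rpower nu (alpha + 4)
      + 3 * Rpower 2 (alpha + 1) * Rpower nu (alpha + 2)
      + Ste * (alpha + 1) * nu ^ 2 - 3 * Ste
      = q * w / 2 + 3 * q + Ste * w - 3 * Ste).
  { replace (alpha + 4) with (alpha + 2 + 2) by ring.
    rewrite (Rpower_plus2 nu (alpha + 2)) by exact Hnu.
    unfold q, w. rewrite (Rpower_plus alpha 1 2), (Rpower_1 2) by lra. field. }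
  assert (Hheat : (2 * a * nu) ^ 2 * (alpha + 1) * (A / 2 + B / 3)
                    = 4 * a ^ 2 * B
                  <-> w * (A / 2 + B / 3) = B).
  { assert (H : 0 < 4 * a ^ 2) by (assert (H := pow_lt a 2 Ha); lra).
    unfold w. split; intros E.
    - apply (Rmult_eq_reg_l (4 * a ^ 2)); lra.
    - apply (f_equal (Rmult (4 * a ^ 2))) in E. lra. }
  rewrite HStefan, Hheat, Hnueq.
  replace (6 * Ste - 2 * Ste * nu ^ 2 * (alpha + 1)
             - 3 * Rpower 2 (alpha + 1) * Rpower nu (alpha + 2))
    with (6 * Ste - 2 * Ste * w - 3 * q) by (unfold w, q; ring).
  replace (- 3 * Ste + 3 * Ste * nu ^ 2 * (alpha + 1)
             + 3 * Rpower 2 (alpha + 1) * Rpower nu (alpha + 2))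
    with (- 3 * Ste + 3 * Ste * w + 3 * q) by (unfold w, q; ring).
  clearbody q w Ste. split.
  - intros (HAB & -> & Hh).
    assert (HB : B = 1 - A) by lra. subst B.
    assert (HA : A * (w + 6) = 6 - 2 * w) by lra.
    split; [| split].
    + apply (f_equal (Rmult Ste)) in HA. lra.
    (* The natural denominator is [w + 6]; subtracting [3 * Ste * A = 3 * q] turns it into the
       [w + 3] of the stated formula. *)
    + apply (Rmult_eq_reg_r (Ste * (w + 3))); [| nra].
      transitivity (Ste * (A * (w + 6)) - 3 * Ste * A); [ring|].
      rewrite HA. field. lra.
    + apply (Rmult_eq_reg_r (Ste * (w + 3))); [| nra].
      transitivity (Ste * (w + 3) - Ste * (A * (w + 6)) + 3 * Ste * A); [ring|].
      rewrite HA. field. lra.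
  - intros (Hq & -> & ->).
    (* The equation for [nu] is linear in [q]. Solving it for [q] reduces the three equations to
       rational identities in [w] and [Ste]. *)
    assert (Hqv : q = Ste * (6 - 2 * w) / (w + 6)).
    { apply (Rmult_eq_reg_r (w + 6)); [| lra].
      transitivity (Ste * (6 - 2 * w)); [lra | field; lra]. }
    rewrite Hqv. repeat split; field; lra.
Qed.

(** * Unique solvability of the equation for [nu] *)

Lemma nu2_equation_unique (Ste alpha x y : R) :
  0 < Ste -> 0 <= alpha -> 0 < x -> 0 < y ->
  nu2_equation Ste alpha x -> nu2_equation Ste alpha y -> x = y.
Proof.
  intros HSte Halpha.
  assert (Hincr : forall u v, 0 < u < v ->
    nu2_equation Ste alpha u -> nu2_equation Ste alpha v -> False).
  { intros u v Huv. unfold nu2_equation.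
    assert (K1 := Rlt_Rpower_l u v (alpha + 4) ltac:(lra) Huv).
    assert (K2 := Rlt_Rpower_l u v (alpha + 2) ltac:(lra) Huv).
    assert (K3 : u ^ 2 < v ^ 2) by nra.
    assert (P1 := Rpower_pos 2 alpha). assert (P2 := Rpower_pos 2 (alpha + 1)).
    apply (Rmult_lt_compat_l (Rpower 2 alpha * (alpha + 1))) in K1;
      [| apply Rmult_lt_0_compat; lra].
    apply (Rmult_lt_compat_l (3 * Rpower 2 (alpha + 1))) in K2; [| lra].
    apply (Rmult_lt_compat_l (Ste * (alpha + 1))) in K3;
      [| apply Rmult_lt_0_compat; lra].
    lra. }
  intros Hx Hy Ex Ey.
  destruct (Rtotal_order x y) as [H | [H | H]]; [| exact H |].
  - destruct (Hincr x y (conj Hx H) Ex Ey).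
  - destruct (Hincr y x (conj Hy H) Ey Ex).
Qed.

Lemma nu2_equation_exists (Ste alpha : R) :
  0 < Ste -> 0 <= alpha -> exists z, 0 < z /\ nu2_equation Ste alpha z.
Proof.
  intros HSte Halpha.
  assert (P1 := Rpower_pos 2 alpha). assert (P2 := Rpower_pos 2 (alpha + 1)).
  set (f := fun z => Rpower 2 alpha * (alpha + 1) * Rpower z (alpha + 4)
    + 3 * Rpower 2 (alpha + 1) * Rpower z (alpha + 2)
    + Ste * (alpha + 1) * z ^ 2 - 3 * Ste).
  assert (C1 : 0 < Rpower 2 alpha * (alpha + 1))
    by (apply Rmult_lt_0_compat; lra).
  assert (C2 : 0 < Ste * (alpha + 1)) by (apply Rmult_lt_0_compat; lra).
  set (K := Rpower 2 alpha * (alpha + 1) + 3 * Rpower 2 (alpha + 1)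
    + Ste * (alpha + 1)).
  assert (HK : 0 < K) by (unfold K; lra).
  (* For [z <= 1] every power of [z] above is at most [z], so [f z <= K z - 3 Ste]. *)
  set (z0 := Ste / (K + Ste)).
  assert (Hz0 : 0 < z0) by (apply Rdiv_lt_0_compat; lra).
  assert (Hz0K : z0 * (K + Ste) = Ste) by (unfold z0; field; lra).
  assert (Hz01 : z0 < 1) by nra.
  (* The left end is [z0] instead of [0] because [Rpower] is the usual power only for a positive
     base; there [f z0 <= K * z0 - 3 * Ste < 0]. At [2] the quadratic term alone is at least
     [4 * Ste], so [f 2 > 0]. *)
  destruct (Ranalysis5.IVT_interv f z0 2) as (z & Hz & Hfz).
  - intros z Hz.
    apply (continuity_pt_minus _ (fun _ => 3 * Ste));
      [| apply continuity_pt_const; intros ? ?; reflexivity].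
    apply (continuity_pt_plus _ (fun z => Ste * (alpha + 1) * z ^ 2)).
    + apply (continuity_pt_plus
        (fun z => Rpower 2 alpha * (alpha + 1) * Rpower z (alpha + 4))
        (fun z => 3 * Rpower 2 (alpha + 1) * Rpower z (alpha + 2)));
        apply continuity_pt_scal, continuity_pt_Rpower; lra.
    + apply continuity_pt_scal.
      apply (derivable_continuous_pt (fun z => z ^ 2)), derivable_pt_pow.
  - lra.
  - assert (K1 := Rpower_le_id z0 (alpha + 4) ltac:(lra) ltac:(lra)).
    assert (K2 := Rpower_le_id z0 (alpha + 2) ltac:(lra) ltac:(lra)).
    assert (K3 : z0 ^ 2 <= z0) by nra.
    apply (Rmult_le_compat_l (Rpower 2 alpha * (alpha + 1))) in K1; [| lra].
    apply (Rmult_le_compat_l (3 * Rpower 2 (alpha + 1))) in K2; [| lra].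
    apply (Rmult_le_compat_l (Ste * (alpha + 1))) in K3; [| lra].
    assert (K4 : K * z0 <= Ste) by nra.
    unfold f. unfold K in K4. lra.
  - assert (K1 := Rmult_lt_0_compat _ _ C1 (Rpower_pos 2 (alpha + 4))).
    assert (K2 := Rmult_lt_0_compat _ _ P2 (Rpower_pos 2 (alpha + 2))).
    assert (K3 : Ste <= Ste * (alpha + 1)) by nra.
    unfold f. lra.
  - exists z. split; [lra | exact Hfz].
Qed.

(** * Existence and uniqueness for (P_2) *)

Theorem theorem3p2 (k rho c gamma theta alpha : R)
    (hk : 0 < k) (hrho : 0 < rho) (hc : 0 < c) (hgamma : 0 < gamma)
    (htheta : 0 < theta) (halpha : 0 <= alpha) :
  let a := diffusion k rho c in
  let Ste := stefan_number k gamma theta alpha a in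
  exists nu2 : R,
    unique (fun z => 0 < z /\ nu2_equation Ste alpha z) nu2 /\
    solves_P2 k rho c gamma theta alpha
      (T2 theta Ste alpha a nu2) (s2 a nu2) /\
    (forall (T : R -> R -> R) (s : R -> R),
       solves_P2 k rho c gamma theta alpha T s ->
       (forall t, 0 <= t -> s t = s2 a nu2 t) /\
       (forall x t, 0 < t -> 0 <= x <= s t ->
          T x t = T2 theta Ste alpha a nu2 x t)).
Proof.
  intros a Ste.
  assert (Ha : 0 < a).
  { apply sqrt_lt_R0, Rdiv_lt_0_compat; [exact hk|].
    apply Rmult_lt_0_compat; assumption. }
  assert (HSte : 0 < Ste).
  { apply Rdiv_lt_0_compat; apply Rmult_lt_0_compat; try assumption.
    apply Rpower_pos. }
  destruct (nu2_equation_exists Ste alpha HSte halpha) as (nu & Hnu & Enu).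
  exists nu. split; [| split].
  - split; [split; assumption|]. intros z [Hz Ez].
    exact (nu2_equation_unique Ste alpha nu z HSte halpha Hnu Hz Enu Ez).
  - apply P2_system_solves; [exact hk | |].
    + repeat apply Rmult_lt_0_compat; lra.
    + apply P2_system_nu; try assumption. repeat split. exact Enu.
  - intros T s Hsol.
    destruct (solves_P2_system _ _ _ _ _ _ _ _ hk hgamma htheta halpha Hsol)
      as (C & A & B & HC & Hsys & Hs & HT).
    fold a in Hsys.
    (* Any positive [C] has the form [2 * a * z] with [z > 0], so the front of an arbitrary solution
       also produces a root of the equation for [nu], which must be [nu]. *)
    assert (HC' : C = 2 * a * (C / (2 * a))) by (field; lra).
    assert (Hz : 0 < C / (2 * a)) by (apply Rdiv_lt_0_compat; lra).
    set (z := C / (2 * a)) in *. clearbody z. subst C.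
    apply P2_system_nu in Hsys; try assumption. fold Ste in Hsys.
    destruct Hsys as (Ez & -> & ->).
    rewrite (nu2_equation_unique Ste alpha z nu HSte halpha Hz Hnu Ez Enu)
      in Hs, HT.
    split; assumption.
Qed.
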